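(* Let $n\ge 2$, let $k_1,\dots,k_n$ be nonnegative integers, let $c_{n+1}\in\mathbb{C}$, and let $\mathfrak{gl}(n+1)$ act on the polynomial algebra $\mathcal{C}_n=\mathbb{C}[x_{i,j}\mid 1\le j\le i\le n]$ by the inductive construction described in the context, with $I_{n+1}=\sum_{i=1}^{n+1}E_{i,i}$ acting as the scalar $c_{n+1}$. Then the representation formulas are as follows: $$E_{i,i}|_{\mathcal{C}_n}=\frac{1}{n+1}c_{n+1}-c_n+\sum_{r=i}^{n}\left(x_{r,i}\partial_{x_{r,i}}-k_{n-r+1}\right)-\sum_{s=1}^{i-1}x_{i-1,s}\partial_{x_{i-1,s}}\qquad\text{for } 1\le i\le n+1,$$ $$E_{i,j}|_{\mathcal{C}_n}=\sum_{r=i-1}^{n}x_{r,i}\partial_{x_{r,j}}\qquad\text{for } 1\le j<i\le n+1,$$ and, for $1\le i<j\le n+1$, $$E_{i,j}|_{\mathcal{C}_n}=\sum_{r=j}^{n}x_{r,i}\partial_{x_{r,j}}+\sum_{s=i-1}^{j-1}\sum_{t=1}^{s}D_{j-1,s}(t)\,x_{s,i}\,\partial_{x_{s,t}}-\sum_{s=i}^{j-1}D_{j-1,s}(i)\,k_{n+1-s}.$$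
   Context: $E_{i,j}$ denotes the matrix unit with $1$ in position $(i,j)$; the base field is $\mathbb{C}$. Convention: $x_{i,j}$ is a variable if $1\le j\le i$, $x_{i,i+1}=-1$, and $x_{i,j}=0$ otherwise. Empty sums are zero. For $1\le j\le i\le n$ and $1\le s\le j$, $D_{i,j}(s)$ is the determinant of the $(i-j+1)\times(i-j+1)$ matrix whose rows are indexed by $l=j,j+1,\dots,i$ and whose $l$-th row is $(x_{l,s},x_{l,j+1},x_{l,j+2},\dots,x_{l,i})$ (where $x_{l,q}$ is a variable if $1\le q\le l$, $x_{l,l+1}=-1$, and $x_{l,q}=0$ otherwise); in particular $D_{i,i}(s)=x_{i,s}$. Construction. For $1\le m\le n$ let $\mathcal{C}_m=\mathbb{C}[x_{i,j}\mid 1\le j\le i\le m]$ and $$c_m=-\frac{1}{m+1}\sum_{i=0}^{m-1}(m-i)\,k_{n-m+1+i}.$$ An action of $\mathfrak{sl}(m+1)$ on $\mathcal{C}_m$ is defined inductively. For $m=1$, $\mathfrak{sl}(2)$ acts on $\mathcal{C}_1=\mathbb{C}[x_{1,1}]$ by $E_{1,2}=x_{1,1}^2\partial_{x_{1,1}}-k_nx_{1,1}$, $E_{2,1}=-\partial_{x_{1,1}}$, $E_{1,1}-E_{2,2}=2x_{1,1}\partial_{x_{1,1}}-k_n$. For $2\le m\le n$, first make $\mathcal{C}_{m-1}$ a $\mathfrak{gl}(m)$-module by letting $I_m=\sum_{i=1}^mE_{i,i}$ act as the scalar $c_m$; view differential operators on $\mathcal{C}_{m-1}$ as differential operators on $\mathcal{C}_m=\mathbb{C}[x_{m,1},\dots,x_{m,m}]\otimes\mathcal{C}_{m-1}$;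 put $\mathcal{D}_m=\sum_{s=1}^mx_{m,s}\partial_{x_{m,s}}$; and for $i,j\in\{1,\dots,m\}$, $i\ne j$, let $$E_{i,j}|_{\mathcal{C}_m}=x_{m,i}\partial_{x_{m,j}}+E_{i,j}|_{\mathcal{C}_{m-1}},$$ $$(E_{i,i}-E_{j,j})|_{\mathcal{C}_m}=x_{m,i}\partial_{x_{m,i}}-x_{m,j}\partial_{x_{m,j}}+(E_{i,i}-E_{j,j})|_{\mathcal{C}_{m-1}},$$ $$E_{i,m+1}|_{\mathcal{C}_m}=x_{m,i}\mathcal{D}_m+c_mx_{m,i}+\sum_{r=1}^mx_{m,r}E_{i,r}|_{\mathcal{C}_{m-1}},\qquad E_{m+1,i}|_{\mathcal{C}_m}=-\partial_{x_{m,i}},$$ $$(E_{m,m}-E_{m+1,m+1})|_{\mathcal{C}_m}=\mathcal{D}_m+x_{m,m}\partial_{x_{m,m}}+c_m+E_{m,m}|_{\mathcal{C}_{m-1}}.$$ Finally the $\mathfrak{sl}(n+1)$-action on $\mathcal{C}_n$ is extended to $\mathfrak{gl}(n+1)$ by letting $I_{n+1}$ act as $c_{n+1}$. *)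

(* Defs.v *)
From mathcomp Require Export all_boot all_order all_algebra.
From mathcomp Require Export complex mpoly reals.

Set Implicit Arguments.
Unset Strict Implicit.
Unset Printing Implicit Defensive.

Import GRing.Theory.
Local Open Scope ring_scope.

(** All indices i, j, m, r, s, t are 1-based natural numbers, as in the
    mathematical text; [inord i.-1] converts them to ordinals. *)

(** The m(m+1)/2 variables x_{i,j}, 1 <= j <= i <= m, are numbered row by row,
    so that the variables of C_{m+1} are those of C_m followed by row m+1. *)
Fixpoint nvars (m : nat) : nat := if m is m'.+1 then nvars m' + m'.+1 else 0.

Notation Cpol R m := {mpoly R[i][nvars m]}.

Definition var_idx (m i j : nat) : option 'I_(nvars m) :=
  if (1 <= j <= i)%N then insub (nvars i.-1 + j.-1)%N else None.

(** x_{i,j} in C_m with the conventions x_{i,i+1} = -1 and x_{i,j} = 0 for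
    j = 0 or j > i+1; a pair with 1 <= j <= i and i > m is not a variable of
    C_m and gets the junk value 0. *)
Definition xv (R : realType) (m i j : nat) : Cpol R m :=
  if var_idx m i j is Some v then 'X_v
  else if j == i.+1 then -1 else 0.

(** The derivation d/dx_{i,j} of C_m (junk value 0 if x_{i,j} is not a variable
    of C_m). *)
Definition dv (R : realType) (m i j : nat) (f : Cpol R m) : Cpol R m :=
  if var_idx m i j is Some v then f^`M(v) else 0.

(** D_{i,j}(s), for 1 <= s <= j <= i <= m. *)
Definition Ddet (R : realType) (m i j s : nat) : Cpol R m :=
  \det (\matrix_(a < i - j + 1, b < i - j + 1)
          xv R m (j + a) (if b == 0%N :> nat then s else j + b)).

(** c_m, where the index n of the sequence k_1, ..., k_n is kept explicit. *)
Definition cst (R : realType) (n : nat) (k : nat -> nat) (m : nat) : R[i] :=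
  - (m.+1%:R)^-1 *
    \sum_(0 <= i < m) (m - i)%:R * (k (n - m + 1 + i)%N)%:R.

Definition Emx (R : realType) (m i j : nat) : 'M[R[i]]_m.+1 :=
  delta_mx (inord i.-1) (inord j.-1).

(** The decomposition C_{m+1} = C[x_{m+1,1}, ..., x_{m+1,m+1}] (x) C_m:
    inclusion of C_m, and the two factors of a monomial of C_{m+1}. *)
Definition incl (R : realType) (m : nat) (f : Cpol R m) : Cpol R m.+1 :=
  f \mPo [tuple 'X_(lshift m.+1 v) | v < nvars m].

Definition mon_old (m : nat) (u : 'X_{1..nvars m.+1}) : 'X_{1..nvars m} :=
  [multinom u (lshift m.+1 v) | v < nvars m].

Definition mon_new (m : nat) (u : 'X_{1..nvars m.+1}) : 'X_{1..nvars m.+1} :=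
  [multinom (if (v < nvars m)%N then 0%N else u v) | v < nvars m.+1].

(** id (x) T for a linear operator T of C_m.  This is how a differential
    operator on C_m is viewed as a differential operator on C_{m+1}. *)
Definition ext_op (R : realType) (m : nat) (T : Cpol R m -> Cpol R m)
    (f : Cpol R m.+1) : Cpol R m.+1 :=
  \sum_(u <- msupp f) f@_u *: ('X_[mon_new u] * incl (T 'X_[mon_old u])).

(** Extension of an action of sl(m+1) to gl(m+1) = sl(m+1) (+) C I_{m+1} in which
    I_{m+1} acts as the scalar c. *)
Definition gl_ext (R : realType) (m : nat)
    (act : 'M[R[i]]_m.+1 -> Cpol R m -> Cpol R m) (c : R[i])
    (A : 'M[R[i]]_m.+1) (f : Cpol R m) : Cpol R m :=
  act (A - (\tr A / m.+1%:R)%:M) f + (\tr A / m.+1%:R * c) *: f.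

(** The action of sl(2) on C_1; only the values on traceless A matter. *)
Definition sl2_act (R : realType) (kn : nat)
    (A : 'M[R[i]]_2) (f : Cpol R 1) : Cpol R 1 :=
  let x := xv R 1 1 1 in let df := dv 1 1 f in
  A 0 1 *: (x ^+ 2 * df - kn%:R *: (x * f)) + A 1 0 *: (- df)
  + A 0 0 *: (2%:R *: (x * df) - kn%:R *: f).

Section InductiveStep.

(** From the action [act] of sl(m) on C_{m-1} to the action of sl(m+1) on C_m,
    with m = m'.+1; [c] is c_m. *)
Variables (R : realType) (m' : nat) (c : R[i]).
Variable act : 'M[R[i]]_m'.+1 -> Cpol R m' -> Cpol R m'.
Let m := m'.+1.

Definition old_sl (A : 'M[R[i]]_m'.+1) : Cpol R m -> Cpol R m :=
  ext_op (act A).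

Definition old_gl (A : 'M[R[i]]_m'.+1) : Cpol R m -> Cpol R m :=
  ext_op (gl_ext act c A).

Definition euler (f : Cpol R m) : Cpol R m :=
  \sum_(1 <= s < m.+1) xv R m m s * dv m s f.

(** E_{i,j}, for i, j in 1..m+1 and i <> j. *)
Definition step_off (i j : nat) (f : Cpol R m) : Cpol R m :=
  if j == m.+1 then
    xv R m m i * euler f + c *: (xv R m m i * f)
    + \sum_(1 <= r < m.+1) xv R m m r * old_gl (Emx R m' i r) f
  else if i == m.+1 then - dv m j f
  else xv R m m i * dv m j f + old_sl (Emx R m' i j) f.

(** E_{i,i} - E_{j,j}, for i, j in 1..m. *)
Definition step_diag (i j : nat) (f : Cpol R m) : Cpol R m :=
  xv R m m i * dv m i f - xv R m m j * dv m j f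
  + old_sl (Emx R m' i i - Emx R m' j j) f.

(** E_{m,m} - E_{m+1,m+1}. *)
Definition step_last (f : Cpol R m) : Cpol R m :=
  euler f + xv R m m m * dv m m f + c *: f + old_gl (Emx R m' m m) f.

(** Linear extension to traceless A, which is the sum of A_{i,j} E_{i,j} for
    i <> j and of A_{i,i} (E_{i,i} - E_{m+1,m+1}) for i <= m, where
    E_{i,i} - E_{m+1,m+1} = (E_{i,i} - E_{m,m}) + (E_{m,m} - E_{m+1,m+1}). *)
Definition sl_step (A : 'M[R[i]]_m.+1) (f : Cpol R m) : Cpol R m :=
  \sum_(i < m.+1) \sum_(j < m.+1 | j != i) A i j *: step_off i.+1 j.+1 f
  + \sum_(i < m.+1 | (i < m)%N) A i i *: (step_diag i.+1 m f + step_last f).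

End InductiveStep.

(** The action of sl(m+1) on C_m, 1 <= m <= n (for m = 0 it is the zero Lie
    algebra that acts). *)
Fixpoint sl_act (R : realType) (n : nat) (k : nat -> nat) (m : nat) :
    'M[R[i]]_m.+1 -> Cpol R m -> Cpol R m :=
  match m return 'M[R[i]]_m.+1 -> Cpol R m -> Cpol R m with
  | 0 => fun _ _ => 0
  | m'.+1 =>
    match m' return ('M[R[i]]_m'.+1 -> Cpol R m' -> Cpol R m') ->
        'M[R[i]]_m'.+2 -> Cpol R m'.+1 -> Cpol R m'.+1 with
    | 0 => fun _ => sl2_act (k n)
    | m''.+1 => @sl_step R m''.+1 (cst R n k m''.+2)
    end (@sl_act R n k m')
  end.

(** The action of gl(n+1) on C_n in which I_{n+1} acts as the scalar c. *)
Definition gl_act (R : realType) (n : nat) (k : nat -> nat) (c : R[i]) :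
    'M[R[i]]_n.+1 -> Cpol R n -> Cpol R n :=
  gl_ext (@sl_act R n k n) c.

(* Main.v *)
From HB Require Import structures.
Require Import Defs.
From mathcomp Require Import zify ring.
Import GRing.Theory.
Local Open Scope ring_scope.

Set Implicit Arguments.
Unset Strict Implicit.
Unset Printing Implicit Defensive.

(** Put W_r(p,t) = [t = r] + [p < r] D_{r-1,p}(t).  With the conventions on x, all
    the formulas, diagonal, lower and upper, become instances of one: for 1 <= i, r
    <= m+1 the operator E_{i,r} on C_m is
      [i = r] (c_{m+1}/(m+1) - c_m) + sum_{i-1 <= p <= m} sum_{1 <= t <= p}
        W_r(p,t) x_{p,i} d/dx_{p,t} - sum_{i <= s <= m} k_{n+1-s} W_r(s,i).
    This goes by induction on m.  Expanding the Hessenberg determinants D along their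
    last row gives W_{m+1}(p,t) = sum_{1 <= r <= m} x_{m,r} W_r(p,t), which is what
    the definition of E_{i,m+1} requires, and the scalars match because
    c_m + c_m/m - c_{m-1} = -k_{n-m+1}.  The differences E_{i,i} - E_{j,j} then
    determine each E_{i,i}, the sum of the claimed formulas being c_{m+1}. *)

(** * Leading minors of Hessenberg matrices *)

(** [M] is an infinite array rather than a matrix, so that minors of all sizes share their entries
    without casts. *)
Definition leading_minor (A : comNzRingType) (M : nat -> nat -> A) (n : nat) : A :=
  \det (\matrix_(a < n, b < n) M a b).

Definition hessenberg (A : comNzRingType) (M : nat -> nat -> A) : Prop :=
  (forall a, M a a.+1 = -1) /\ (forall a b, (a.+1 < b)%N -> M a b = 0).

(* Multiplying on the right by the unipotent matrix whose first column lists the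
   smaller minors clears the first column above its last entry. *)
Lemma leading_minor_rec (A : comNzRingType) (M : nat -> nat -> A) (n : nat) :
  hessenberg M ->
  leading_minor M n.+1 = \sum_(0 <= q < n.+1) M n q * leading_minor M q.
Proof.
move=> [Mdiag Mup]; elim/ltn_ind: n => n IHn.
set S := (RHS).
pose U : 'M[A]_n.+1 :=
  \matrix_(a, b) if b == 0%N :> nat then leading_minor M a else (a == b)%:R.
pose B : 'M[A]_n.+1 :=
  \matrix_(a, b) if b == 0%N :> nat then (if a == n :> nat then S else 0) else M a b.
have detU : \det U = 1.
  rewrite det_trig; last first.
    apply/is_trig_mxP => a b ab; rewrite mxE.
    by case: eqP => [b0|_]; [rewrite b0 in ab | rewrite -val_eqE ltn_eqF].
  apply: big1 => a _; rewrite mxE; case: eqP => [->|_]; last by rewrite eqxx.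
  by rewrite /leading_minor det_mx00.
have AU : (\matrix_(a < n.+1, b < n.+1) M a b) *m U = B.
  apply/matrixP => a b; rewrite !mxE.
  under eq_bigr do rewrite !mxE.
  case: eqP => [b0|_]; last first.
    rewrite (bigD1 b) //= eqxx mulr1 big1 ?addr0 // => q qb.
    by rewrite (negPf qb) mulr0.
  move: (ltn_ord a); rewrite ltnS leq_eqVlt; case: eqP => [an _|_ /= an].
  - by rewrite -(big_mkord xpredT (fun q => M a q * leading_minor M q)) an.
  (* For a < n the terms q <= a add up to the minor of size a + 1 by induction; the term q = a + 1,
     with entry -1, cancels it, and further entries are 0. *)
  - rewrite -(big_mkord xpredT (fun q => M a q * leading_minor M q)).
    rewrite (big_cat_nat (n := a.+2)) //=.
    rewrite big_nat_recr //= -IHn // Mdiag mulN1r subrr add0r.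
    rewrite big_nat_cond big1 // => q; rewrite andbT => /andP[aq _].
    by rewrite Mup ?mul0r.
have detB : \det B = S.
  rewrite (expand_det_col _ ord0) (bigD1 ord_max) //= big1 => [|a an]; last first.
    rewrite mxE /= -val_eqE /= in an *.
    by rewrite (negPf an) mul0r.
  (* Deleting the last row and the first column leaves a lower triangular matrix with -1 on the
     diagonal, so the cofactor is (-1)^n (-1)^n = 1. *)
  rewrite mxE /= eqxx addr0 /cofactor addn0 det_trig; last first.
    apply/is_trig_mxP => a b ab; rewrite !mxE /= Mup //.
    by rewrite /bump leq0n (leqNgt n) ltn_ord.
  under eq_bigr => a _ do
    rewrite !mxE /= /bump leq0n (leqNgt n) ltn_ord /= add0n add1n Mdiag.
  by rewrite prodr_const card_ord -exprMn mulrNN mulr1 expr1n mulr1.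
by rewrite /leading_minor -[LHS]mulr1 -detU -det_mulmx AU detB.
Qed.

Lemma leading_minor_rmorph (A B : comNzRingType) (g : {rmorphism A -> B})
    (M : nat -> nat -> A) (N : nat -> nat -> B) (n : nat) :
  (forall a b, (a < n)%N -> g (M a b) = N a b) ->
  g (leading_minor M n) = leading_minor N n.
Proof.
move=> gM; rewrite /leading_minor -det_map_mx; congr (\det _).
by apply/matrixP => a b; rewrite !mxE gM.
Qed.

(** * Numbering of the variables and inclusion of C_m in C_{m+1} *)

Lemma leq_nvars (m m' : nat) : (m <= m')%N -> (nvars m <= nvars m')%N.
Proof.
elim: m' => [|m' IH]; rewrite leq_eqVlt => /predU1P[->|] // /IH /leq_trans.
by apply; rewrite leq_addr.
Qed.

(** Row i starts at position [nvars i.-1] and ends just before [nvars i], so the row alone decides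
    whether a variable lies in C_m. *)
Lemma nvars_index (m i j : nat) :
  (1 <= j <= i)%N -> (nvars i.-1 + j.-1 < nvars m)%N = (i <= m)%N.
Proof.
case: i j => [|i] [|j] //= ji; apply/idP/idP => [|im]; last first.
  by apply: leq_trans (leq_nvars im); rewrite /= ltn_add2l.
apply: contraLR; rewrite -!leqNgt => mi.
by apply: leq_trans (leq_nvars mi) (leq_addr _ _).
Qed.

Lemma var_idx_lift (m i j : nat) : (i <= m)%N ->
  var_idx m.+1 i j = omap (lshift m.+1) (var_idx m i j).
Proof.
move=> im; rewrite /var_idx; case: ifP => // ji.
have lt1 : (nvars i.-1 + j.-1 < nvars m)%N by rewrite nvars_index.
have lt2 : (nvars i.-1 + j.-1 < nvars m.+1)%N by rewrite nvars_index ?leqW.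
by rewrite !insubT; congr Some; apply: val_inj.
Qed.

Lemma xv_succ (R : realType) (m i : nat) : xv R m i i.+1 = -1.
Proof. by rewrite /xv /var_idx ltnn andbF eqxx. Qed.

Lemma xv_above (R : realType) (m i j : nat) : (i.+1 < j)%N -> xv R m i j = 0.
Proof.
by move=> ij; rewrite /xv /var_idx [(j <= i)%N]leqNgt (ltnW ij) andbF gtn_eqF.
Qed.

Lemma incl_is_linear (R : realType) (m : nat) : linear (@incl R m).
Proof. by move=> a f g; rewrite /incl linearP. Qed.

HB.instance Definition _ (R : realType) (m : nat) :=
  GRing.isLinear.Build R[i] (Cpol R m) (Cpol R m.+1) _ (@incl R m)
    (@incl_is_linear R m).

Lemma incl_is_monoid_morphism (R : realType) (m : nat) :
  monoid_morphism (@incl R m).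
Proof. by split=> [|f g]; rewrite /incl ?rmorph1 ?rmorphM. Qed.

HB.instance Definition _ (R : realType) (m : nat) :=
  GRing.isMonoidMorphism.Build (Cpol R m) (Cpol R m.+1) (@incl R m)
    (@incl_is_monoid_morphism R m).

Lemma incl_var (R : realType) (m : nat) (v : 'I_(nvars m)) :
  incl ('X_v : Cpol R m) = 'X_(lshift m.+1 v).
Proof. by rewrite /incl comp_mpolyXU -tnth_nth tnth_mktuple. Qed.

(** The bound matters at i = m + 1: for 1 <= j <= i, [xv] is the junk value 0 in C_m but a variable
    in C_{m+1}. *)
Lemma incl_xv (R : realType) (m i j : nat) : (i <= m)%N ->
  incl (xv R m i j) = xv R m.+1 i j.
Proof.
move=> im; rewrite /xv var_idx_lift //; case: (var_idx m i j) => [v|] /=.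
  exact: incl_var.
by case: ifP => _; rewrite ?rmorphN1 ?raddf0.
Qed.

Lemma incl_mpolyX (R : realType) (m : nat) (u : 'X_{1..nvars m}) :
  incl ('X_[u] : Cpol R m) = \prod_v 'X_(lshift m.+1 v) ^+ u v.
Proof.
rewrite mpolyXE_id rmorph_prod; apply: eq_bigr => v _.
by rewrite rmorphXn /= incl_var.
Qed.

Lemma monomial_split (R : realType) (m : nat) (u : 'X_{1..nvars m.+1}) :
  'X_[mon_new u] * incl ('X_[mon_old u] : Cpol R m) = 'X_[u].
Proof.
rewrite incl_mpolyX !mpolyXE_id !big_split_ord /=.
rewrite big1 => [|v _]; last by rewrite mnmE /= ltn_ord.
rewrite mul1r mulrC; congr (_ * _); apply: eq_bigr => v _; rewrite mnmE //=.
by rewrite ltnNge leq_addr.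
Qed.

(** * Differential operators on C_m viewed on C_{m+1} *)

Section ExtOp.
Variables (R : realType) (m : nat).
Implicit Types (T : Cpol R m -> Cpol R m) (f : Cpol R m.+1).

Lemma eq_ext_op T1 T2 : T1 =1 T2 -> ext_op T1 =1 ext_op T2.
Proof. by move=> eqT f; apply: eq_bigr => u _; rewrite eqT. Qed.

Lemma ext_opD T1 T2 f :
  ext_op (fun g => T1 g + T2 g) f = ext_op T1 f + ext_op T2 f.
Proof.
rewrite -big_split; apply: eq_bigr => u _.
by rewrite raddfD mulrDr scalerDr.
Qed.

Lemma ext_opZ a T f : ext_op (fun g => a *: T g) f = a *: ext_op T f.
Proof.
rewrite scaler_sumr; apply: eq_bigr => u _.
by rewrite linearZ /= -scalerAr scalerA mulrC -scalerA.
Qed.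

Lemma ext_opB T1 T2 f :
  ext_op (fun g => T1 g - T2 g) f = ext_op T1 f - ext_op T2 f.
Proof.
under eq_ext_op do rewrite -scaleN1r.
by rewrite ext_opD ext_opZ scaleN1r.
Qed.

Lemma ext_op0 f : ext_op (fun _ : Cpol R m => 0) f = 0.
Proof. by apply: big1 => u _; rewrite raddf0 mulr0 scaler0. Qed.

Lemma ext_op_sum I (r : seq I) (P : pred I) (T : I -> Cpol R m -> Cpol R m) f :
  ext_op (fun g => \sum_(i <- r | P i) T i g) f
    = \sum_(i <- r | P i) ext_op (T i) f.
Proof.
rewrite exchange_big; apply: eq_bigr => u _.
by rewrite raddf_sum mulr_sumr scaler_sumr.
Qed.

Lemma ext_op_mul (P : Cpol R m) f : ext_op (fun g => P * g) f = incl P * f.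
Proof.
rewrite [in RHS](mpolyE f) mulr_sumr; apply: eq_bigr => u _.
by rewrite rmorphM /= mulrCA monomial_split scalerAr.
Qed.

Lemma ext_op_id f : ext_op id f = f.
Proof.
rewrite (eq_ext_op (fun g => esym (mul1r g))).
by rewrite ext_op_mul rmorph1 mul1r.
Qed.

(** The factor [mon_new u] contains no old variable, so an old derivation acts on the factor from
    C_m alone and meets the same exponent there. *)
Lemma ext_op_mul_mderiv (P : Cpol R m) (v : 'I_(nvars m)) f :
  ext_op (fun g => P * g^`M(v)) f = incl P * f^`M(lshift m.+1 v).
Proof.
rewrite [in RHS](mpolyE f) raddf_sum mulr_sumr; apply: eq_bigr => u _.
rewrite rmorphM /= mulrCA scalerAr mderivZ; congr (_ * (_ *: _)).
rewrite !mderivX linearZ /= -scalerAr mnmE; congr (_ *: _).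
rewrite incl_mpolyX !mpolyXE_id !big_split_ord /=.
rewrite big1 => [|w _]; last by rewrite mnmE /= ltn_ord.
rewrite mul1r mulrC; congr (_ * _); apply: eq_bigr => w _; rewrite !mnmE //=.
by rewrite ltnNge leq_addr eq_lrshift subn0.
Qed.

Lemma ext_op_mul_dv (P : Cpol R m) (i j : nat) f : (i <= m)%N ->
  ext_op (fun g => P * dv i j g) f = incl P * dv i j f.
Proof.
move=> im; rewrite /dv var_idx_lift //; case: (var_idx m i j) => [v|] /=.
  exact: ext_op_mul_mderiv.
by under eq_ext_op do rewrite mulr0; rewrite ext_op0 mulr0.
Qed.

End ExtOp.

(** * The weights W_r(p,t) and their recursion *)

Section Formula.
Variables (R : realType) (n : nat) (k : nat -> nat).

(* The matrix of D_{r-1,p}(t), which is its leading minor of size r - p. *)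
Definition weight_entry (L p t a b : nat) : Cpol R L :=
  xv R L (p + a) (if b == 0%N then t else (p + b)%N).

(** For t <= p at most one summand survives: the determinant if p < r, the Kronecker delta if r <=
    p. *)
Definition weight (L r p t : nat) : Cpol R L :=
  (t == r)%:R
  + (if (p < r)%N then leading_minor (weight_entry L p t) (r - p) else 0).

Lemma weight_entry_hessenberg (L p t : nat) : hessenberg (weight_entry L p t).
Proof.
split=> [a|a [|b] ab] //; rewrite /weight_entry /=.
  by rewrite addnS xv_succ.
by rewrite xv_above // addnS ltnS -addnS leq_add2l.
Qed.

Lemma weight_ge (L r p t : nat) : (r <= p)%N -> weight L r p t = (t == r)%:R.
Proof. by move=> rp; rewrite /weight ltnNge rp addr0. Qed.

Lemma weight_Ddet (L r p t : nat) : (t <= p < r)%N ->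
  weight L r p t = Ddet R L r.-1 p t.
Proof.
move=> /andP[tp pr].
rewrite /weight pr ltn_eqF ?add0r; last exact: leq_ltn_trans tp pr.
rewrite /Ddet /leading_minor.
have -> // : (r - p = r.-1 - p + 1)%N.
by case: r pr => // r pr; rewrite addn1 /= subSn.
Qed.

Lemma sum_pick (V : nmodType) (m t : nat) (F : nat -> V) : (1 <= t <= m)%N ->
  \sum_(1 <= r < m.+1) (if t == r then F r else 0) = F t.
Proof.
move=> tm; rewrite (bigD1_seq t) ?iota_uniq ?mem_index_iota //= eqxx.
by rewrite big1 ?addr0 // => r /negPf; rewrite eq_sym => ->.
Qed.

Lemma sum_ord_succ (V : nmodType) (m : nat) (F : nat -> V) :
  \sum_(a < m) F a.+1 = \sum_(1 <= l < m.+1) F l.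
Proof. by rewrite big_add1 big_mkord. Qed.

Lemma sum_delta (A : pzSemiRingType) (m t : nat) (F : nat -> A) : (1 <= t <= m)%N ->
  \sum_(1 <= r < m.+1) (r == t)%:R * F r = F t.
Proof.
move=> tm; rewrite -(sum_pick F tm); apply: eq_bigr => r _.
by rewrite mulr_natl mulrb eq_sym.
Qed.

(** The minor is expanded along its last row, which is row m of x. The term q = 0 is x_{m,t},
    supplied on the right by the Kronecker deltas; a term q >= 1 is the one for r = p + q. *)
Lemma weight_rec (L m p t : nat) : (1 <= t <= p)%N -> (p <= m)%N ->
  weight L m.+1 p t = \sum_(1 <= r < m.+1) xv R L m r * weight L r p t.
Proof.
move=> /andP[t0 tp] pm; have tm := leq_trans tp pm.
under eq_bigr do rewrite mulrDr.
rewrite big_split /=; under eq_bigr do rewrite mulr_natr mulrb.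
rewrite sum_pick ?t0 //.
rewrite /weight ltnS pm ltn_eqF // add0r subSn //.
rewrite leading_minor_rec; last exact: weight_entry_hessenberg.
rewrite [LHS]big_nat_recl // {1}/weight_entry /= subnKC //.
rewrite {1}/leading_minor det_mx00 mulr1.
rewrite [X in _ = _ + X](big_cat_nat (n := p.+1)) //=.
rewrite [X in _ = _ + (X + _)]big_nat_cond.
rewrite [X in _ = _ + (X + _)]big1 => [|r /andP[/andP[_ rp] _]]; last first.
  by rewrite ltnNge -ltnS rp mulr0.
congr (_ + _).
rewrite add0r -{1}[p.+1]add0n big_addn subSS; apply: eq_big_nat => q _.
by rewrite addnS ltnS leq_addl -addSn addnK /weight_entry /= subnKC // addnC.
Qed.

Lemma weight_rec_diag (L p t : nat) : (1 <= t <= p)%N ->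
  weight L p.+1 p t = xv R L p t.
Proof.
move=> tp; rewrite weight_rec //.
rewrite -[RHS](sum_pick (xv R L p) tp); apply: eq_big_nat => r /andP[_ rp].
by rewrite weight_ge // mulr_natr mulrb.
Qed.

(** The minor involves only the rows p to r - 1, all at most m. *)
Lemma incl_weight (m r p t : nat) : (r <= m.+1)%N ->
  incl (weight m r p t) = weight m.+1 r p t.
Proof.
move=> rm; rewrite /weight rmorphD rmorph_nat; congr (_ + _).
case: ifP => pr; last exact: raddf0.
apply: leading_minor_rmorph => a b ar; apply: incl_xv.
by rewrite -ltnS (leq_trans _ rm) // -ltn_subRL.
Qed.

(** * The uniform formula and its growth by one row *)

(** [L] counts the rows of the ambient ring, [m] those of the formula; they are kept apart because
    the operators of C_m are also read in C_{m+1}. *)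
Definition gl_formula (L m : nat) (a : R[i]) (i r : nat) (f : Cpol R L) : Cpol R L :=
  (if i == r then a else 0) *: f
  + \sum_(i.-1 <= p < m.+1) \sum_(1 <= t < p.+1)
      weight L r p t * xv R L p i * dv p t f
  - \sum_(i <= s < m.+1) (k (n + 1 - s))%:R *: (weight L r s i * f).

Lemma ext_gl_formula (m : nat) (a : R[i]) (i r : nat) (f : Cpol R m.+1) :
  (r <= m.+1)%N ->
  ext_op (gl_formula m a i r) f = gl_formula m a i r f.
Proof.
move=> rm; rewrite ext_opB ext_opD ext_opZ ext_op_id !ext_op_sum.
congr (_ + _ - _); apply: eq_big_nat => p /andP[_ pm].
  rewrite ext_op_sum; apply: eq_bigr => t _.
  by rewrite ext_op_mul_dv // rmorphM /= incl_weight // incl_xv.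
by rewrite ext_opZ ext_op_mul incl_weight.
Qed.

Section Rows.
Variable L : nat.
Implicit Type f : Cpol R L.

Lemma gl_formula_shift (m : nat) (a b : R[i]) (i : nat) f :
  gl_formula m a i i f = gl_formula m b i i f + (a - b) *: f.
Proof. by rewrite /gl_formula eqxx scalerBl; ring. Qed.

Lemma gl_formula_off (m : nat) (a b : R[i]) (i r : nat) f :
  i != r -> gl_formula m a i r f = gl_formula m b i r f.
Proof. by move=> /negPf ir; rewrite /gl_formula ir. Qed.

(** For r <= m + 1 the weights in row m + 1 are Kronecker deltas, so the new row contributes one
    derivation and, if i = r, one constant. *)
Lemma gl_formula_row (m : nat) (a : R[i]) (i r : nat) f :
  (1 <= i <= m.+1)%N -> (1 <= r <= m.+1)%N ->
  gl_formula m.+1 a i r f = gl_formula m a i r f + xv R L m.+1 i * dv m.+1 r f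
     - (if i == r then (k (n + 1 - m.+1))%:R else 0) *: f.
Proof.
move=> /andP[i0 im] rm; rewrite /gl_formula (big_nat_recr m.+1) /=; last first.
  exact: leq_trans (leq_pred _) im.
rewrite (big_nat_recr m.+1 i) //=.
under [X in _ + (_ + X)]eq_bigr => t _.
  rewrite weight_ge; last by case/andP: rm.
  rewrite -mulrA.
  over.
rewrite sum_delta // weight_ge; last by case/andP: rm.
by case: eqP => _; rewrite ?mul1r ?mul0r ?scaler0 ?scale0r; ring.
Qed.

Lemma gl_formula_last_row (m : nat) (a : R[i]) (r : nat) f :
  (1 <= r <= m.+1)%N -> gl_formula m.+1 a m.+2 r f = - dv m.+1 r f.
Proof.
move=> rm; rewrite /gl_formula [X in _ - X]big_geq // big_nat1 subr0.
rewrite gtn_eqF; last by case/andP: rm.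
under eq_bigr => t _.
  rewrite xv_succ weight_ge; last by case/andP: rm.
  rewrite -mulrA mulN1r.
  over.
by rewrite sum_delta // scale0r add0r.
Qed.

(** Only p = m occurs, where x_{m,m+1} = -1 and W_{m+1}(m,t) = x_{m,t}. *)
Lemma gl_formula_last (m : nat) (a : R[i]) f :
  gl_formula m a m.+1 m.+1 f
    = a *: f - \sum_(1 <= s < m.+1) xv R L m s * dv m s f.
Proof.
rewrite /gl_formula [X in _ - X]big_geq // big_nat1 subr0 eqxx -sumrN.
congr (_ + _); apply: eq_big_nat => t tm.
by rewrite xv_succ weight_rec_diag // mulrN1 mulNr.
Qed.

(** Rows p <= m come from the recursion for W_{m+2}(p,t), and row m + 1 gives the Euler term. The
    scalar [b] of the old operators is free, being subtracted again; the induction uses the value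
    with b + k_{n-m} = -c_{m+1}. *)
Lemma gl_formula_last_col (m : nat) (a b : R[i]) (i : nat) f :
  (1 <= i <= m.+1)%N ->
  gl_formula m.+1 a i m.+2 f =
    xv R L m.+1 i * \sum_(1 <= s < m.+2) xv R L m.+1 s * dv m.+1 s f
    - (b + (k (n + 1 - m.+1))%:R) *: (xv R L m.+1 i * f)
    + \sum_(1 <= r < m.+2) xv R L m.+1 r * gl_formula m b i r f.
Proof.
move=> /andP[i0 im]; rewrite /gl_formula ltn_eqF // scale0r add0r.
rewrite (big_nat_recr m.+1) /=; last exact: leq_trans (leq_pred _) im.
rewrite (big_nat_recr m.+1 i) //= weight_rec_diag ?i0 //.
have -> : \sum_(1 <= r < m.+2) xv R L m.+1 r *
    ((if i == r then b else 0) *: f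
     + \sum_(i.-1 <= p < m.+1) \sum_(1 <= t < p.+1)
         weight L r p t * xv R L p i * dv p t f
     - \sum_(i <= s < m.+1) (k (n + 1 - s))%:R *: (weight L r s i * f))
  = b *: (xv R L m.+1 i * f)
    + \sum_(i.-1 <= p < m.+1) \sum_(1 <= t < p.+1)
         weight L m.+2 p t * xv R L p i * dv p t f
    - \sum_(i <= s < m.+1) (k (n + 1 - s))%:R *: (weight L m.+2 s i * f).
  under eq_bigr do rewrite mulrBr mulrDr.
  rewrite sumrB big_split /=; congr (_ + _ - _).
  - rewrite -(sum_pick (fun r => b *: (xv R L m.+1 r * f)) (t := i) (m := m.+1)) ?i0 //.
    apply: eq_bigr => r _; case: eqP => _; first by rewrite scalerAr.
    by rewrite scale0r mulr0.
  - under eq_bigr do rewrite mulr_sumr.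
    rewrite exchange_big /=; apply: eq_big_nat => p /andP[_ pm].
    under eq_bigr do rewrite mulr_sumr.
    rewrite exchange_big /=; apply: eq_big_nat => t tp.
    rewrite weight_rec //; last exact: ltnW.
    by rewrite !mulr_suml; apply: eq_bigr => r _; rewrite !mulrA.
  - under eq_bigr do rewrite mulr_sumr.
    rewrite exchange_big /=; apply: eq_big_nat => s /andP[si sm].
    rewrite weight_rec ?i0 //; last exact: ltnW.
    by rewrite mulr_suml scaler_sumr; apply: eq_bigr => r _; rewrite -scalerAr mulrA.
have -> : \sum_(1 <= t < m.+2) weight L m.+2 m.+1 t * xv R L m.+1 i * dv m.+1 t f
   = xv R L m.+1 i * \sum_(1 <= s < m.+2) xv R L m.+1 s * dv m.+1 s f.
  rewrite mulr_sumr; apply: eq_big_nat => t tm.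
  by rewrite weight_rec_diag // -mulrA mulrCA.
rewrite scalerDl; ring.
Qed.

(** The derivations that row m + 1 adds to the first m + 1 operators form the Euler operator that
    the last one subtracts. What this row leaves is m + 1 copies of k_{n-m}. *)
Lemma sum_gl_formula_diag (m : nat) (a : R[i]) f :
  \sum_(1 <= l < m.+2) gl_formula m a l l f =
  (m.+1%:R * a - \sum_(1 <= s < m.+1) (s * k (n + 1 - s))%:R) *: f.
Proof.
elim: m => [|m IHm].
  rewrite big_nat1 gl_formula_last big_geq // subr0.
  by rewrite big_geq // subr0 mul1r.
rewrite big_nat_recr //= gl_formula_last.
under eq_big_nat => l lm do rewrite gl_formula_row // eqxx.
rewrite sumrB big_split /= IHm sumr_const_nat subn1 /=.
rewrite [X in _ = (_ - X) *: _]big_nat_recr //= mulnC mulrnA scalerMnl.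
rewrite -[m.+2%:R]natr1 mulrDl mul1r opprD addrACA !scalerDl !scaleNr.
ring.
Qed.

End Rows.

(** * The scalars c_m *)

(** Substitute s = m - i; the bound m <= n keeps the truncated subtraction in the index of k
    exact. *)
Lemma cst_sum (m : nat) : (m <= n)%N ->
  m.+1%:R * cst R n k m = - \sum_(1 <= s < m.+1) (s * k (n + 1 - s))%:R.
Proof.
move=> mn; rewrite /cst mulNr mulrN mulVKf ?Num.Theory.pnatr_eq0 //; congr (- _).
rewrite big_nat_rev big_add1 /=; apply: eq_big_nat => i /andP[_ im].
rewrite add0n -natrM subKn //; congr (_ * k _)%:R.
lia.
Qed.

(** This is (m + 2) c_{m+1} - (m + 1) c_m = -(m + 1) k_{n-m} divided by m + 1. *)
Lemma cst_step (m : nat) : (m < n)%N ->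
  cst R n k m.+1 + (m.+1%:R^-1 * cst R n k m.+1 - cst R n k m)
    = - (k (n + 1 - m.+1))%:R.
Proof.
move=> mn; have m_neq0 : m.+1%:R != 0 :> R[i] by rewrite Num.Theory.pnatr_eq0.
apply: (mulfI m_neq0); rewrite mulrDr mulrBr mulVKf // cst_sum ?(ltnW mn) //.
rewrite addrA -[X in _ + X - _]mul1r -mulrDl natr1 cst_sum //.
by rewrite big_nat_recr //= opprD opprK addrAC addNr add0r natrM mulrN.
Qed.

(** * Matrix units and the action of sl(m+1) *)

Lemma Emx_entry (m : nat) (i j : nat) (a b : 'I_m.+1) :
  (1 <= i <= m.+1)%N -> (1 <= j <= m.+1)%N ->
  Emx R m i j a b = ((a.+1 == i) && (b.+1 == j))%:R.
Proof.
case: i j => [|i] [|j] //= im jm.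
by rewrite mxE -!val_eqE /= !inordK.
Qed.

Lemma trace_Emx (m : nat) (i j : nat) :
  (1 <= i <= m.+1)%N -> (1 <= j <= m.+1)%N -> \tr (Emx R m i j) = (i == j)%:R.
Proof.
move=> im jm; rewrite /mxtrace.
under eq_bigr do rewrite Emx_entry // -mulnb natrM.
by rewrite (sum_ord_succ _ (fun a => (a == i)%:R * (a == j)%:R)) sum_delta.
Qed.

Lemma sum_ord2_step (A : pzRingType) (V : lmodType A) (M : 'M[A]_2)
    (F : nat -> nat -> V) (G : nat -> V) :
  \sum_(i < 2) \sum_(j < 2 | j != i) M i j *: F i.+1 j.+1
    + \sum_(i < 2 | (i < 1)%N) M i i *: G i.+1
  = M 0 1 *: F 1%N 2%N + M 1 0 *: F 2%N 1%N + M 0 0 *: G 1%N.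
Proof.
under eq_bigr do rewrite big_mkcond.
rewrite [X in _ + X = _]big_mkcond !big_ord_recl !big_ord0 /= !add0r !addr0.
have -> : lift ord0 ord0 = 1 :> 'I_2 by apply: val_inj.
by have -> : ord0 = 0 :> 'I_2 by apply: val_inj.
Qed.

Lemma sum_delta_mx_off (A : pzRingType) (V : lmodType A) (m : nat) (i j : 'I_m)
    (F : 'I_m -> 'I_m -> V) : i != j ->
  \sum_(a < m) \sum_(b < m | b != a) delta_mx i j a b *: F a b = F i j.
Proof.
move=> ij; rewrite (bigD1 i) //= (bigD1 j) /=; last by rewrite eq_sym.
rewrite mxE !eqxx scale1r big1 => [|b /andP[_ /negPf bj]]; last first.
  by rewrite mxE bj andbF scale0r.
rewrite big1 ?addr0 // => a /negPf ai.
by apply: big1 => b _; rewrite mxE ai scale0r.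
Qed.

(** The given sl(2)-action is itself the inductive step from the zero action on C_0, because c_0 = 0
    and 2 c_1 = -k_n. Hence the induction can start at m = 0. *)
Lemma sl_act_step (m : nat) (A : 'M[R[i]]_m.+2) (f : Cpol R m.+1) : (m < n)%N ->
  sl_act n k A f = sl_step (cst R n k m.+1) (@sl_act R n k m) A f.
Proof.
case: m A f => [|m] A f mn; last by [].
have c1 : cst R n k 1 + cst R n k 1 = - (k n)%:R.
  have := cst_step mn.
  rewrite invr1 mul1r subn1 addn1 /= => <-.
  suff -> : cst R n k 0 = 0 by rewrite subr0.
  by rewrite /cst big_geq // mulr0.
have gl0 g : old_gl (cst R n k 1) (@sl_act R n k 0) (Emx R 0 1 1) g = cst R n k 1 *: g.
  rewrite /old_gl (eq_ext_op (T2 := fun h => cst R n k 1 *: h)); last first.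
    by move=> h; rewrite /gl_ext /= add0r trace_Emx // divr1 mul1r.
  by rewrite ext_opZ ext_op_id.
have old0 : old_sl (@sl_act R n k 0) (Emx R 0 1 1 - Emx R 0 1 1) f = 0.
  exact: ext_op0.
rewrite /sl_step (sum_ord2_step A (fun i j => step_off _ _ i j f)
  (fun i => step_diag _ i 1 f + step_last _ _ f)).
rewrite /step_off /step_diag /step_last /euler /= !big_nat1 !gl0 old0.
have kE : (k n)%:R%:MP_[nvars 1] = - ((cst R n k 1)%:MP + (cst R n k 1)%:MP).
  by rewrite -mpolyCD c1 mpolyCN opprK.
rewrite /sl2_act -!mul_mpolyC kE mpolyC_nat.
ring.
Qed.

Lemma sl_step_sub (m : nat) (c : R[i]) act (A B : 'M[R[i]]_m.+2) (f : Cpol R m.+1) :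
  sl_step c act (A - B) f = sl_step c act A f - sl_step c act B f.
Proof.
rewrite /sl_step opprD addrACA -!sumrB; congr (_ + _).
  apply: eq_bigr => i _; rewrite -sumrB; apply: eq_bigr => j _.
  by rewrite !mxE scalerBl.
by apply: eq_bigr => i _; rewrite !mxE scalerBl.
Qed.

Lemma sl_act_sub (m : nat) (A B : 'M[R[i]]_m.+1) (f : Cpol R m) : (m <= n)%N ->
  sl_act n k (A - B) f = sl_act n k A f - sl_act n k B f.
Proof.
case: m A B f => [|m] A B f mn; first by rewrite subr0.
by rewrite !sl_act_step // sl_step_sub.
Qed.

(** * Extension to gl(m+1) and the induction on m *)

Lemma gl_ext_traceless (m : nat) act (c : R[i]) (A : 'M[R[i]]_m.+1) (f : Cpol R m) :
  \tr A = 0 -> gl_ext act c A f = act A f.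
Proof.
by move=> trA; rewrite /gl_ext trA !mul0r scale0r addr0 raddf0 subr0.
Qed.

(** This evaluates the action on E_{l,l} - E_{m,m} through the two matrix units, whose operators the
    induction hypothesis gives one by one. *)
Lemma gl_ext_sl_act_sub (m : nat) (c : R[i]) (A B : 'M[R[i]]_m.+1) (f : Cpol R m) :
  (m <= n)%N ->
  gl_ext (@sl_act R n k m) c (A - B) f
    = gl_ext (@sl_act R n k m) c A f - gl_ext (@sl_act R n k m) c B f.
Proof.
move=> mn; rewrite /gl_ext raddfB /= !mulrBl raddfB /= scalerBl.
have -> (X Y : 'M[R[i]]_m.+1) : A - B - (X - Y) = (A - X) - (B - Y).
  by rewrite !opprD addrACA.
by rewrite sl_act_sub // opprD addrACA.
Qed.

(* The scalar c has to be arbitrary here: the construction uses c = c_{m+1}. *)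
Lemma gl_ext_sl_act (m : nat) (c : R[i]) (i r : nat) (f : Cpol R m) :
  (m <= n)%N -> (1 <= i <= m.+1)%N -> (1 <= r <= m.+1)%N ->
  gl_ext (@sl_act R n k m) c (Emx R m i r) f =
  gl_formula m (m.+1%:R^-1 * c - cst R n k m) i r f.
Proof.
elim: m c i r f => [|m IHm] c i r f mn im rm.
  have -> : i = 1%N by case: i im => [|[]].
  have -> : r = 1%N by case: r rm => [|[]].
  rewrite gl_formula_last big_geq // subr0 /gl_ext trace_Emx // add0r.
  by rewrite invr1 /cst big_geq // mulr0 subr0 ?mulr1 !mul1r.
(* [a0] is the diagonal scalar that the induction hypothesis yields on C_m when I_{m+1} acts as
   c_{m+1}; naming it makes it an atom for [ring]. *)
have [a0 a0E] : {a0 | m.+1%:R^-1 * cst R n k m.+1 - cst R n k m = a0} by eexists.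
have kE : (k (n + 1 - m.+1))%:R = - (cst R n k m.+1 + a0).
  by rewrite -a0E cst_step // opprK.
have old_glE j s g : (1 <= j <= m.+1)%N -> (1 <= s <= m.+1)%N ->
    old_gl (cst R n k m.+1) (@sl_act R n k m) (Emx R m j s) g = gl_formula m a0 j s g.
  move=> jm sm; rewrite -ext_gl_formula; last by case/andP: sm.
  by apply: eq_ext_op => h; rewrite IHm ?a0E // ltnW.
have old_slE A g : \tr A = 0 -> old_sl (@sl_act R n k m) A g
    = old_gl (cst R n k m.+1) (@sl_act R n k m) A g.
  by move=> trA; apply: eq_ext_op => h; rewrite gl_ext_traceless.
have offE j s g : (1 <= j <= m.+2)%N -> (1 <= s <= m.+2)%N -> j != s ->
    step_off (cst R n k m.+1) (@sl_act R n k m) j s g = gl_formula m.+1 0 j s g.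
  move=> /andP[j0 jm] /andP[s0 sm] js; rewrite /step_off.
  case: (eqVneq s m.+2) => [sE | s_neq].
    subst s; have jm' : (1 <= j <= m.+1)%N by rewrite j0 -ltnS ltn_neqAle js.
    rewrite (gl_formula_last_col _ a0) //.
    have -> : a0 + (k (n + 1 - m.+1))%:R = - cst R n k m.+1.
      by rewrite kE; ring.
    rewrite scaleNr opprK; congr (_ + _); apply: eq_big_nat => t tm.
    by rewrite old_glE.
  have sm' : (1 <= s <= m.+1)%N by rewrite s0 -ltnS ltn_neqAle s_neq.
  case: (eqVneq j m.+2) => [-> | j_neq]; first by rewrite gl_formula_last_row.
  have jm' : (1 <= j <= m.+1)%N by rewrite j0 -ltnS ltn_neqAle j_neq.
  rewrite gl_formula_row // (negPf js) scale0r subr0 addrC old_slE; last first.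
    by rewrite trace_Emx // (negPf js).
  by rewrite (old_glE _ _ _ jm' sm') (gl_formula_off _ a0 0 _ js).
(* The scalar [a] cancels in the difference, so it can be chosen later to match the claim. *)
have diagE l g a : (1 <= l <= m.+1)%N ->
    step_diag (@sl_act R n k m) l m.+1 g
      + step_last (cst R n k m.+1) (@sl_act R n k m) g
    = gl_formula m.+1 a l l g - gl_formula m.+1 a m.+2 m.+2 g.
  move=> lm; rewrite gl_formula_row // gl_formula_last /step_diag /step_last.
  rewrite old_slE; last by rewrite raddfB /= !trace_Emx ?leqnn // !eqxx subrr.
  have -> : old_gl (cst R n k m.+1) (@sl_act R n k m)
        (Emx R m l l - Emx R m m.+1 m.+1) g
      = gl_formula m a0 l l g - gl_formula m a0 m.+1 m.+1 g.
    rewrite -!old_glE ?leqnn // -ext_opB; apply: eq_ext_op => h.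
    by rewrite gl_ext_sl_act_sub // ltnW.
  rewrite old_glE ?leqnn // (gl_formula_shift m a a0) eqxx /euler.
  rewrite kE !(scalerDl, scaleNr).
  move: (gl_formula _ _ _ _ _) (gl_formula _ _ _ _ _).
  move: (\sum_(_ <= _ < _) _) (xv R m.+1 m.+1 l) (dv m.+1 l g) (xv R m.+1 m.+1 m.+1)
    (dv m.+1 m.+1 g) => e x dx y dy u v; ring.
have [ir|ir] := eqVneq i r; last first.
  rewrite gl_ext_traceless ?trace_Emx ?(negPf ir) // sl_act_step //.
  rewrite (gl_formula_off _ _ 0) // -offE // /sl_step.
  case: i im ir => // i im ir; case: r rm ir => // r rm ir.
  have IJ : inord i != inord r :> 'I_m.+2.
    by rewrite -val_eqE /= !inordK.
  rewrite (sum_delta_mx_off (fun a b => step_off _ _ a.+1 b.+1 f) IJ) !inordK //.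
  rewrite big1 ?addr0 // => a _; rewrite mxE.
  by case: eqP => [->|_]; rewrite ?(negPf IJ) scale0r.
subst r; rewrite /gl_ext trace_Emx // eqxx sl_act_step //.
set x := 1 / _; set a1 := _ - cst R n k m.+1.
rewrite /sl_step big1 ?add0r => [|a _]; last first.
  apply: big1 => b ba; rewrite !mxE [a == b]eq_sym (negPf ba) subr0.
  case: andP => [[/eqP aI /eqP bI]|_]; last exact: scale0r.
  by rewrite aI bI eqxx in ba.
rewrite big_mkcond.
(* The index a = m + 1, left out by [sl_step], would contribute a difference of equal operators; the
   sum may thus run over the whole diagonal. *)
under eq_bigr => a _.
  have -> : (if (a < m.+1)%N then (Emx R m.+1 i i - x%:M) a a *:
        (step_diag (@sl_act R n k m) a.+1 m.+1 f
         + step_last (cst R n k m.+1) (@sl_act R n k m) f) else 0)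
      = (a.+1 == i)%:R *:
          (gl_formula m.+1 a1 a.+1 a.+1 f - gl_formula m.+1 a1 m.+2 m.+2 f)
        - x *: (gl_formula m.+1 a1 a.+1 a.+1 f - gl_formula m.+1 a1 m.+2 m.+2 f).
    rewrite -scalerBl mxE Emx_entry // andbb !mxE eqxx mulr1n.
    case: ltnP => am; first by rewrite (diagE a.+1 f a1 am).
    have -> : a = m.+1 :> nat by apply/eqP; rewrite eqn_leq am -ltnS ltn_ord.
    by rewrite subrr scaler0.
  over.
rewrite sumrB -scaler_sumr sumrB sumr_const card_ord.
rewrite (sum_ord_succ _ (fun l => (l == i)%:R *: (gl_formula m.+1 a1 l l f
  - gl_formula m.+1 a1 m.+2 m.+2 f))).
under [X in X - _]eq_bigr do rewrite scaler_nat mulrb eq_sym.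
rewrite sum_pick // (sum_ord_succ _ (fun l => gl_formula m.+1 a1 l l f)).
rewrite sum_gl_formula_diag.
have m_neq0 : m.+2%:R != 0 :> R[i] by rewrite Num.Theory.pnatr_eq0.
(* The claimed diagonal operators add up to c, so [E_{i,i} - x I] acts as the claimed E_{i,i} minus
   x c, and the scalar part of [gl_ext] restores x c. *)
have -> : m.+2%:R * a1 - \sum_(1 <= s < m.+2) (s * k (n + 1 - s))%:R = c.
  by rewrite mulrBr mulVKf // cst_sum // opprK addrK.
move: (gl_formula m.+1 a1 i i f) (gl_formula m.+1 a1 m.+2 m.+2 f) => u v.
rewrite scalerBr scalerA -scaler_nat scalerA divfK // scale1r.
by rewrite opprB addrA subrK subrK.
Qed.

(** * The diagonal, lower and upper cases of the uniform formula *)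

Section Unfold.
Variables (L m : nat) (a : R[i]).
Implicit Type f : Cpol R L.

Lemma sum_weight_ge (p i r : nat) f : (1 <= r <= p)%N ->
  \sum_(1 <= t < p.+1) weight L r p t * xv R L p i * dv p t f
    = xv R L p i * dv p r f.
Proof.
move=> /andP[r0 rp]; under eq_bigr do rewrite weight_ge // -mulrA.
by rewrite sum_delta // r0.
Qed.

(** The row p = i - 1 is split off: there x_{i-1,i} = -1 and W_i(i-1,s) = x_{i-1,s}, which gives the
    subtracted sum. *)
Lemma gl_formula_diagonal (i : nat) f : (1 <= i <= m.+1)%N ->
  gl_formula m a i i f =
    a *: f + \sum_(i <= r < m.+1) (xv R L r i * dv r i f - (k (n + 1 - r))%:R *: f)
    - \sum_(1 <= s < i) xv R L i.-1 s * dv i.-1 s f.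
Proof.
case: i => // i im; rewrite /gl_formula eqxx big_ltn //= sumrB.
under [X in _ + (X + _) - _ = _]eq_big_nat => t ti do
  rewrite xv_succ weight_rec_diag // mulrN1 mulNr.
under [X in _ + (_ + X) - _ = _]eq_big_nat => p /andP[ip _].
  rewrite sum_weight_ge //.
  over.
under [X in _ - X = _]eq_big_nat => s /andP[si _] do
  rewrite weight_ge // eqxx mul1r.
by rewrite sumrN; ring.
Qed.

Lemma gl_formula_lower (i j : nat) f : (1 <= j < i)%N ->
  gl_formula m a i j f = \sum_(i.-1 <= r < m.+1) xv R L r i * dv r j f.
Proof.
move=> /andP[j0 ji]; rewrite /gl_formula gtn_eqF // scale0r add0r.
rewrite [X in _ - X]big_nat_cond [X in _ - X]big1 => [|s]; last first.
  move=> /andP[/andP[si _] _]; rewrite weight_ge ?(leq_trans (ltnW ji)) //.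
  by rewrite gtn_eqF // mul0r scaler0.
rewrite subr0; apply: eq_big_nat => p /andP[ip _].
by rewrite sum_weight_ge // j0 (leq_trans _ ip) // -ltnS (ltn_predK ji).
Qed.

(** The sums are split at j: rows p < j have determinants as weights, rows p >= j Kronecker deltas,
    whose constants vanish since i differs from j. *)
Lemma gl_formula_upper (i j : nat) f : (1 <= i < j)%N -> (j <= m.+1)%N ->
  gl_formula m a i j f =
    \sum_(j <= r < m.+1) xv R L r i * dv r j f
    + \sum_(i.-1 <= s < j) \sum_(1 <= t < s.+1)
        Ddet R L j.-1 s t * xv R L s i * dv s t f
    - \sum_(i <= s < j) (k (n + 1 - s))%:R *: (Ddet R L j.-1 s i * f).
Proof.
move=> /andP[i0 ij] jm; rewrite /gl_formula (ltn_eqF ij) scale0r add0r.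
rewrite (big_cat_nat (leq_trans (leq_pred i) (ltnW ij)) jm).
rewrite [X in _ - X = _](big_cat_nat (ltnW ij) jm).
under [X in X + _ - _ = _]eq_big_nat => p /andP[_ pj].
  under eq_big_nat => t /andP[_ tp].
    rewrite weight_Ddet; last by rewrite pj andbT -ltnS.
    over.
  over.
under [X in _ + X - _ = _]eq_big_nat => p /andP[jp _].
  rewrite sum_weight_ge; last by rewrite jp (leq_trans i0 (ltnW ij)).
  over.
under [X in _ - (X + _) = _]eq_big_nat => s sij.
  rewrite weight_Ddet; last exact: sij.
  over.
under [X in _ - (_ + X) = _]eq_big_nat => s /andP[js _].
  rewrite (weight_ge _ _ js) (ltn_eqF ij) mul0r scaler0.
  over.
by rewrite big1_eq addr0 [X in X - _ = _]addrC.
Qed.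

End Unfold.

End Formula.

(* R[i] is the field of complex numbers; c is c_{n+1}. *)
Theorem theorem2p3 (R : realType) (n : nat) (hn : (2 <= n)%N)
    (k : nat -> nat) (c : R[i]) :
  (forall (i : nat), (1 <= i <= n.+1)%N -> forall f : Cpol R n,
     gl_act k c (Emx R n i i) f =
       ((n.+1%:R)^-1 * c - cst R n k n) *: f
       + \sum_(i <= r < n.+1)
           (xv R n r i * dv r i f - (k (n - r + 1)%N)%:R *: f)
       - \sum_(1 <= s < i) xv R n i.-1 s * dv i.-1 s f)
  /\ (forall (i j : nat), (1 <= j < i)%N -> (i <= n.+1)%N ->
      forall f : Cpol R n,
     gl_act k c (Emx R n i j) f =
       \sum_(i.-1 <= r < n.+1) xv R n r i * dv r j f)
  /\ (forall (i j : nat), (1 <= i < j)%N -> (j <= n.+1)%N ->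
      forall f : Cpol R n,
     gl_act k c (Emx R n i j) f =
       \sum_(j <= r < n.+1) xv R n r i * dv r j f
       + \sum_(i.-1 <= s < j) \sum_(1 <= t < s.+1)
           Ddet R n j.-1 s t * xv R n s i * dv s t f
       - \sum_(i <= s < j)
           (k (n + 1 - s)%N)%:R *: (Ddet R n j.-1 s i * f)).
Proof.
split; [|split].
- move=> i iN f.
  rewrite /gl_act (gl_ext_sl_act _ _ _ (leqnn n) iN iN).
  rewrite (gl_formula_diagonal _ _ _ _ iN).
  (* With truncated subtraction, [n - r + 1] equals [n + 1 - r] because r <= n. *)
  under [X in _ = _ + X - _]eq_big_nat => r /andP[_ rn].
    rewrite addnBAC; last exact: rn.
    over.
  by [].
- move=> i j /andP[j0 ji] iN f; have i0 := ltn_trans j0 ji.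
  have iN' : (1 <= i <= n.+1)%N by rewrite i0.
  have jN' : (1 <= j <= n.+1)%N by rewrite j0 (leq_trans (ltnW ji)).
  rewrite /gl_act (gl_ext_sl_act _ _ _ (leqnn n) iN' jN').
  by apply: gl_formula_lower; rewrite j0.
- move=> i j /andP[i0 ij] jN f; have j0 := ltn_trans i0 ij.
  have iN' : (1 <= i <= n.+1)%N by rewrite i0 (leq_trans (ltnW ij)).
  have jN' : (1 <= j <= n.+1)%N by rewrite j0.
  rewrite /gl_act (gl_ext_sl_act _ _ _ (leqnn n) iN' jN').
  by apply: gl_formula_upper; rewrite ?i0.
Qed.
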